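(* Suppose the functions $c_{ij}(\pi)$, $1\le i,j\le d$, are $C^1$ functions of $\pi$. Consider the entropy penalized model with parameter $\epsilon>0$. Then for all sufficiently large $\epsilon$ there is a unique stationary solution $(\bar\pi,\bar V)\in\mathbb{S}\times\mathbb{R}^d/\mathbb{R}$. Additionally, for such $\epsilon$, if $T:\mathbb{S}\times\mathbb{R}^d/\mathbb{R}\to\mathbb{S}\times\mathbb{R}^d/\mathbb{R}$ is given by $T(\pi,V)=(\mathcal{K}_V(\pi),\mathcal{G}_\pi(V))$, then $T^2=T\circ T$ is a strong contraction, i.e. Lipschitz with some constant strictly less than $1$.
   Context: Let $d>1$ be an integer and $\mathbb{S}=\{(q_1,\dots,q_d): q_j\ge 0\ \forall j,\ \sum_{j=1}^d q_j=1\}$. The functions $c_{ij}$ are defined and $C^1$ on (a neighborhood in $\mathbb{R}^d$ of) $\mathbb{S}$. The entropy penalized model is given by $e_i(\pi,P,V)=\sum_j P_{ij}\left(c_{ij}(\pi)+\epsilon\ln P_{ij}+V_j\right)$ for $\pi\in\mathbb{S}$, $V\in\mathbb{R}^d$ and $P$ a $d\times d$ row-stochastic matrix (with $0\ln 0=0$). Its unique minimizing transition matrix is $P_{ij}(\pi,V)=\dfrac{e^{-(c_{ij}(\pi)+V_j)/\epsilon}}{\sum_k e^{-(c_{ik}(\pi)+V_k)/\epsilon}}$. Define $\mathcal{G}_\pi(V)_i=e_i(\pi,P(\pi,V),V)=-\epsilon\ln\left[\sum_k e^{-(c_{ik}(\pi)+V_k)/\epsilon}\right]$ and $\mathcal{K}_V(\pi)=\pi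 P(\pi,V)$ (both depend on $\epsilon$). $\mathbb{R}^d/\mathbb{R}$ is the set of equivalence classes of vectors in $\mathbb{R}^d$ whose components differ by the same constant, with norm $\|\psi\|_\#=\inf_{\lambda\in\mathbb{R}}\|\psi+\lambda\|$ (the scalar $\lambda$ is added to every component; $\|\cdot\|$ is a fixed norm on $\mathbb{R}^d$). Since $\mathcal{G}_\pi(V+\lambda)=\mathcal{G}_\pi(V)+\lambda$ and $\mathcal{K}_{V+\lambda}=\mathcal{K}_V$ for scalars $\lambda$, both operators are well defined for $V\in\mathbb{R}^d/\mathbb{R}$. A stationary solution is a pair $(\bar\pi,\bar V)$ with $\mathcal{K}_{\bar V}(\bar\pi)=\bar\pi$ and $\mathcal{G}_{\bar\pi}(\bar V)=\bar V+\bar\lambda$ for some $\bar\lambda\in\mathbb{R}$, i.e. a fixed point of $T$ in $\mathbb{S}\times\mathbb{R}^d/\mathbb{R}$. The product carries the metric induced by $\|\pi\|+\|V\|_\#$. *)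

(* Defs.v *)
From HB Require Import structures.
From mathcomp Require Import all_boot all_order all_algebra.
From mathcomp Require Import all_classical all_reals all_analysis.
From mathcomp Require Import ring.

Set Implicit Arguments.
Unset Strict Implicit.
Unset Printing Implicit Defensive.

Import Order.TTheory GRing.Theory Num.Theory.
Import numFieldNormedType.Exports.

Local Open Scope classical_set_scope.
Local Open Scope quotient_scope.
Local Open Scope ring_scope.

Definition simplex (R : realType) (d : nat) : set 'rV[R]_d :=
  [set q | (forall j, 0 <= q 0 j) /\ \sum_j q 0 j = 1].

Definition row_stochastic (R : realType) (d : nat) (P : 'M[R]_d) : Prop :=
  (forall i j, 0 <= P i j) /\ (forall i, \sum_j P i j = 1).

(* In finite dimension, continuity of every 'D_v f amounts to continuity of the
   differential 'd f. *)
Definition C1_on (R : realType) (d : nat) (U : set 'rV[R]_d)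
    (f : 'rV[R]_d -> R) : Prop :=
  (forall x, U x -> differentiable f x) /\
  (forall v x, U x -> {for x, continuous (fun y => 'D_v f y)}).

Definition is_norm (R : realType) (d : nat) (N : 'rV[R]_d -> R) : Prop :=
  [/\ forall u v, N (u + v) <= N u + N v,
      forall a v, N (a *: v) = `|a| * N v
    & forall v, N v = 0 -> v = 0].

Section Model.
Variables (R : realType) (d : nat) (c : 'I_d -> 'I_d -> 'rV[R]_d -> R) (eps : R).
Implicit Types (pi V : 'rV[R]_d) (P : 'M[R]_d) (i j : 'I_d).

(* The cost e_i(pi, P, V), with 0 ln 0 = 0 because ln 0 = 0 in the library. *)
Definition cost pi P V i : R :=
  \sum_j P i j * (c i j pi + eps * ln (P i j) + V 0 j).

Definition weight pi V i j : R := expR (- (c i j pi + V 0 j) / eps).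

Definition gibbs pi V : 'M[R]_d :=
  \matrix_(i, j) (weight pi V i j / \sum_k weight pi V i k).

Definition Gop pi V : 'rV[R]_d := \row_i cost pi (gibbs pi V) V i.

Definition Kop V pi : 'rV[R]_d := pi *m gibbs pi V.

Lemma sum_weight_gt0 pi V i : 0 < \sum_k weight pi V i k.
Proof.
rewrite (bigD1 i) //= ltr_wpDr ?expR_gt0 //.
by apply: sumr_ge0 => k _; apply: expR_ge0.
Qed.

Lemma gibbs_gt0 pi V i j : 0 < gibbs pi V i j.
Proof. by rewrite mxE divr_gt0 ?expR_gt0 ?sum_weight_gt0. Qed.

Lemma gibbs_stochastic pi V : row_stochastic (gibbs pi V).
Proof.
split=> [i j|i]; first exact/ltW/gibbs_gt0.
under eq_bigr do rewrite mxE.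
by rewrite -mulr_suml divff // gt_eqF // sum_weight_gt0.
Qed.

Lemma weight_logE pi V i j : eps != 0 ->
  c i j pi + V 0 j = - eps * ln (weight pi V i j).
Proof. by move=> e0; rewrite expRK mulNr mulrCA mulfV // mulr1 opprK. Qed.

Lemma ln_gibbs pi V i j :
  ln (gibbs pi V i j) = ln (weight pi V i j) - ln (\sum_k weight pi V i k).
Proof. by rewrite mxE ln_div ?posrE ?expR_gt0 ?sum_weight_gt0. Qed.

Lemma GopE pi V i : eps != 0 ->
  Gop pi V 0 i = - eps * ln (\sum_k weight pi V i k).
Proof.
move=> e0; rewrite mxE /cost.
have h j : c i j pi + eps * ln (gibbs pi V i j) + V 0 j =
    - eps * ln (\sum_k weight pi V i k).
  by rewrite addrAC weight_logE // ln_gibbs; ring.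
under eq_bigr do rewrite h.
by rewrite -mulr_suml (gibbs_stochastic pi V).2 mul1r.
Qed.

Lemma gibbs_ineq (p q : R) : 0 <= p -> 0 < q ->
  p - q <= p * (ln p - ln q) ?= iff (p == q).
Proof.
rewrite le_eqVlt => /predU1P[<-|p0] q0; apply/leifP.
  by rewrite [0 == q]lt_eqF // mul0r sub0r oppr_lt0.
have [->|pq] := eqVneq p q; first by rewrite !subrr mulr0.
rewrite -subr_gt0 (_ : _ - _ = p * (q / p - (1 + ln (q / p)))); last first.
  by rewrite ln_div ?posrE //; field; rewrite gt_eqF.
have qp0 : 0 < q / p by rewrite divr_gt0.
rewrite mulr_gt0 // subr_gt0 -[ltRHS](@lnK R) ?posrE // expR_gt1Dx //.
rewrite ln_eq0 //; apply: contra_neq pq => /(canRL (mulfVK _)) ->.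
  by rewrite mul1r.
by rewrite gt_eqF.
Qed.

(* Each row of [gibbs] is the unique minimizer of [cost] among probability
   vectors. *)
Lemma gibbs_argmin pi V P i : 0 < eps -> row_stochastic P ->
  cost pi (gibbs pi V) V i <= cost pi P V i ?=
    iff [forall j, P i j == gibbs pi V i j].
Proof.
move=> e0 [P0 P1]; have en0 : eps != 0 by rewrite gt_eqF.
have h : cost pi P V i = cost pi (gibbs pi V) V i +
    eps * \sum_j P i j * (ln (P i j) - ln (gibbs pi V i j)).
  have := GopE pi V i en0; rewrite mxE => ->.
  rewrite -[- eps * _]mul1r -(P1 i) mulr_suml mulr_sumr -big_split /=.
  apply: eq_bigr => j _; rewrite addrAC weight_logE // ln_gibbs; ring.
have := leif_sum (fun j (_ : xpredT j) =>
  gibbs_ineq (P0 i j) (gibbs_gt0 pi V i j)).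
rewrite sumrB P1 (gibbs_stochastic pi V).2 subrr => H.
by rewrite h -[X in X <= _ ?= iff _]addr0 (mono_leif (lerD2l _))
   -[X in X <= _ ?= iff _](mulr0 eps) (mono_leif (ler_pM2l e0)).
Qed.

Lemma Kop_simplex V pi : simplex pi -> simplex (Kop V pi).
Proof.
move=> [pi0 pi1]; have [P0 P1] := gibbs_stochastic pi V; split=> [j|].
  by rewrite mxE; apply: sumr_ge0 => k _; rewrite mulr_ge0.
under eq_bigr do rewrite mxE.
rewrite exchange_big -[RHS]pi1; apply: eq_bigr => k _.
by rewrite -mulr_sumr P1 mulr1.
Qed.

Lemma weight_shift pi V l i j :
  weight pi (V + const_mx l) i j = expR (- l / eps) * weight pi V i j.
Proof. by rewrite /weight -expRD !mxE; congr expR; ring. Qed.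

Lemma gibbs_shift pi V l : gibbs pi (V + const_mx l) = gibbs pi V.
Proof.
apply/matrixP => i j; rewrite !mxE weight_shift.
under eq_bigr do rewrite weight_shift.
by rewrite -mulr_sumr -mulf_div divff ?mul1r // gt_eqF ?expR_gt0.
Qed.

Lemma Kop_shift V l pi : Kop (V + const_mx l) pi = Kop V pi.
Proof. by rewrite /Kop gibbs_shift. Qed.

Lemma Gop_shift pi V l : Gop pi (V + const_mx l) = Gop pi V + const_mx l.
Proof.
apply/rowP => i; rewrite !mxE gibbs_shift /cost.
have h j : (V + const_mx l) 0 j = V 0 j + l by rewrite !mxE.
under eq_bigr do rewrite h addrA mulrDr.
by rewrite big_split /= -mulr_suml (gibbs_stochastic pi V).2 mul1r.
Qed.

End Model.

Definition constv (R : realType) (d : nat) : {pred 'rV[R]_d} :=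
  fun v => `[< exists l, v = const_mx l >].

Lemma constv_zmod_closed (R : realType) (d : nat) : zmod_closed (@constv R d).
Proof.
split; first by apply/asboolP; exists 0; apply/rowP => i; rewrite !mxE.
move=> u v /asboolP[a ->] /asboolP[b ->]; apply/asboolP; exists (a - b).
by apply/rowP => i; rewrite !mxE.
Qed.

HB.instance Definition _ (R : realType) (d : nat) :=
  GRing.isZmodClosed.Build 'rV[R]_d (@constv R d) (@constv_zmod_closed R d).

(* R^d / R *)
Notation potential R d := {ideal_quot (@constv R d)}.

Lemma potential_eqP (R : realType) (d : nat) (v w : 'rV[R]_d) :
  \pi_(potential R d) v = \pi_(potential R d) w <->
  exists l, v = w + const_mx l.
Proof.
rewrite (rwP eqP) -Quotient.idealrBE; split=> [/asboolP[l vw]|[l ->]].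
  by exists l; rewrite -vw addrC subrK.
by apply/asboolP; exists l; rewrite addrC addKr.
Qed.

Notation state R d := (set_type (@simplex R d) * potential R d)%type.

Section Quotient.
Variables (R : realType) (d : nat).
Implicit Types (N : 'rV[R]_d -> R).

Lemma repr_pi (v : 'rV[R]_d) :
  exists l, repr (\pi_(potential R d) v) = v + const_mx l.
Proof. by apply/potential_eqP; rewrite reprK. Qed.

(* By [qnorm_pi] below, the value does not depend on the representative; the
   same holds of [Kq] and [Gq] by [val_Kq] and [Gq_pi]. *)
Definition qnorm N (psi : potential R d) : R :=
  inf [set N (repr psi + const_mx l) | l in [set: R]].

Lemma qnorm_pi N (v : 'rV[R]_d) :
  qnorm N (\pi_(potential R d) v) = inf [set N (v + const_mx l) | l in [set: R]].
Proof.
have [a E] := repr_pi v; rewrite /qnorm E; congr inf.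
have cD (x y : R) : const_mx x + const_mx y = const_mx (x + y) :> 'rV[R]_d.
  by apply/rowP => i; rewrite !mxE.
apply/seteqP; split=> _ [l _ <-] /=.
  by exists (a + l) => //; rewrite -cD addrA.
by exists (l - a) => //; rewrite -addrA cD [a + _]addrC subrK.
Qed.

Definition dist N (x y : state R d) : R :=
  N (val x.1 - val y.1) + qnorm N (x.2 - y.2).

Variables (c : 'I_d -> 'I_d -> 'rV[R]_d -> R) (eps : R).

Definition Kq (psi : potential R d) (pi : set_type (@simplex R d)) :
    set_type (@simplex R d) :=
  SigSub (mem_set (Kop_simplex c eps (repr psi) (set_mem (valP pi)))).

Definition Gq (pi : set_type (@simplex R d)) (psi : potential R d) :
    potential R d :=
  \pi_(potential R d) (Gop c eps (val pi) (repr psi)).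

Definition Tmap (x : state R d) : state R d := (Kq x.2 x.1, Gq x.1 x.2).

Lemma val_Kq (v : 'rV[R]_d) pi :
  val (Kq (\pi_(potential R d) v) pi) = Kop c eps v (val pi).
Proof. by have [l E] := repr_pi v; rewrite /= E Kop_shift. Qed.

Lemma Gq_pi pi (v : 'rV[R]_d) :
  Gq pi (\pi_(potential R d) v) = \pi_(potential R d) (Gop c eps (val pi) v).
Proof.
have [l E] := repr_pi v; apply/potential_eqP; exists l.
by rewrite E Gop_shift.
Qed.

Definition stationary (x : state R d) : Prop :=
  Kop c eps (repr x.2) (val x.1) = val x.1 /\
  exists l, Gop c eps (val x.1) (repr x.2) = repr x.2 + const_mx l.

Lemma stationaryP x : stationary x <-> Tmap x = x.
Proof.
case: x => pi psi; rewrite /stationary /Tmap /=; split=> [[kE gE]|[kE gE]].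
  congr pair; first exact: val_inj.
  by rewrite /Gq -[RHS]reprK; apply/potential_eqP.
split; first by rewrite -[in RHS]kE.
by apply/potential_eqP; rewrite reprK.
Qed.

End Quotient.

(* Main.v *)
(* As eps grows the costs are damped: the rows of the Gibbs matrix P(pi, V) are
   comparable up to the factor exp(2 M / eps), uniformly in V, where M bounds
   c_ij - c_kj on the simplex. Since pi - pi' has zero sum and G_pi has the
   Gibbs matrix as differential, this makes K contract in pi and G contract in
   V (modulo constants) at rate O(1/eps); K depends on V only through V/eps.
   The single remaining dependence, that of G on pi, is Lipschitz with constant
   O(1), so T itself need not contract, but T^2 does: every two-step path uses a
   small coefficient. Banach's theorem gives a fixed point of T^2, which is
   unique, hence also fixed by T. *)

Require Import Defs.
From HB Require Import structures.
From mathcomp Require Import all_boot all_order all_algebra.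
From mathcomp Require Import all_classical all_reals all_analysis.
From mathcomp Require Import ring lra.

Set Implicit Arguments.
Unset Strict Implicit.
Unset Printing Implicit Defensive.

Import Order.TTheory GRing.Theory Num.Theory.
Import numFieldNormedType.Exports.

Local Open Scope classical_set_scope.
Local Open Scope ring_scope.

(** * The simplex and norms on row vectors *)

Lemma rV_normP (R : realType) (d : nat) (v : 'rV[R]_d) (M : R) :
  0 <= M -> (forall j, `|v 0 j| <= M) -> `|v| <= M.
Proof.
move=> M0 h; rewrite [leLHS]/Num.Def.normr/= mx_normrE bigmax_le//= => -[i j] _.
by rewrite ord1.
Qed.

Lemma rV_coord_le (R : realType) (d : nat) (v : 'rV[R]_d) j : `|v 0 j| <= `|v|.
Proof.
rewrite [leRHS]/Num.Def.normr/= mx_normrE.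
by apply/bigmax_geP; right => /=; exists (0, j).
Qed.

Lemma simplex_le1 (R : realType) (d : nat) (p : 'rV[R]_d) j :
  simplex p -> p 0 j <= 1.
Proof.
move=> [p0 <-]; rewrite (bigD1 j)//= lerDl; exact: sumr_ge0.
Qed.

Lemma simplex_closed (R : realType) (d : nat) : closed (@simplex R d).
Proof.
have -> : @simplex R d = \bigcap_j [set p : 'rV[R]_d | 0 <= p 0 j] `&`
    [set p : 'rV[R]_d | \sum_j p 0 j = 1].
  apply/seteqP; split=> [p [p0 p1]|p [p0 p1]]; split=> [j|].
  - by move=> _; exact: (p0 j).
  - by [].
  - exact: (p0 j I).
  - by [].
apply: closedI.
  apply: closed_bigI => j _.
  have /continuous_closedP h := @coord_continuous R 1 d 0 j.
  exact: (h [set x | 0 <= x] (@closed_ge R 0)).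
suff sc : continuous (fun p : 'rV[R]_d => \sum_j p 0 j).
  by move/continuous_closedP : sc => h; exact: (h _ (@closed_eq R 1)).
apply: continuous_big => [|j _]; first exact: add_continuous.
exact: coord_continuous.
Qed.

Lemma simplex_compact (R : realType) (d : nat) : compact (@simplex R d).
Proof.
apply: bounded_closed_compact; last exact: simplex_closed.
exists 1; split=> // M M1 p Sp /=; apply/(le_trans _ (ltW M1))/rV_normP => // j.
by rewrite ger0_norm ?simplex_le1//; case: Sp.
Qed.

Lemma simplex_norm_le1 (R : realType) (d : nat) (p q : 'rV[R]_d) :
  simplex p -> simplex q -> `|p - q| <= 1.
Proof.
move=> Sp Sq; apply: rV_normP => // j; rewrite !mxE.
have := simplex_le1 j Sp; have := simplex_le1 j Sq.
case: Sp => /(_ j) + _; case: Sq => /(_ j) + _.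
rewrite ler_norml; move: (p 0 j) (q 0 j) => x y; lra.
Qed.

Lemma simplex_segment (R : realType) (d : nat) (p q : 'rV[R]_d) (t : R) :
  simplex p -> simplex q -> 0 <= t <= 1 -> simplex (t *: (q - p) + p).
Proof.
move=> [p0 p1] [q0 q1] /andP[t0 t1]; split=> [j|].
  rewrite !mxE; move: (p0 j) (q0 j); move: (p 0 j) (q 0 j) => x y; nra.
under eq_bigr do rewrite !mxE.
by rewrite big_split/= -mulr_sumr sumrB p1 q1 subrr mulr0 add0r.
Qed.

Lemma simplex_delta (R : realType) (d : nat) (i : 'I_d) :
  simplex (delta_mx 0 i : 'rV[R]_d).
Proof.
split=> [j|]; first by rewrite mxE; case: eqP.
rewrite (bigD1 i)//= mxE !eqxx/= big1 ?addr0// => j ji.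
by rewrite mxE (negbTE ji) andbF.
Qed.

(** Partial derivatives are continuous, hence bounded, on the compact simplex. The mean value
    theorem is applied along segments of the simplex, which is convex, so [U] may have any shape. *)
Lemma C1_lipschitz (R : realType) (d : nat) (U : set 'rV[R]_d)
    (f : 'rV[R]_d -> R) :
  @simplex R d `<=` U -> C1_on U f ->
  exists2 L : R, 0 <= L & forall p q, simplex p -> simplex q ->
    `|f p - f q| <= L * `|p - q|.
Proof.
move=> SU [df cdf].
have bnd v : exists2 B : R, 0 <= B & forall p, simplex p -> `|'D_v f p| <= B.
  have : bounded_set ((fun y => 'D_v f y) @` @simplex R d).
    apply: compact_bounded; apply: continuous_compact; last exact: simplex_compact.
    by apply: continuous_in_subspaceT => p /set_mem/SU; exact: cdf.
  move=> [B [_ hB]]; exists (Num.max (B + 1) 0); first by rewrite le_max lexx orbT.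
  by move=> p Sp; rewrite le_max (hB _ _ ('D_v f p)) ?ltrDl//; exists p.
have [B B0 hB] : exists2 B : 'I_d -> R, (forall j, 0 <= B j) &
    forall j p, simplex p -> `|'D_(delta_mx 0 j) f p| <= B j.
  by exists (fun j => s2val (cid2 (bnd (delta_mx 0 j)))) => j; case: cid2.
exists (\sum_j B j); first exact: sumr_ge0.
move=> q p Sq Sp.
(* Linearity of the differential, with [q - p] expanded in the standard basis. *)
have Dle z : simplex z -> `|'D_(q - p) f z| <= (\sum_j B j) * `|q - p|.
  move=> Sz; rewrite deriveE; last exact/df/SU.
  rewrite {1}(row_sum_delta (q - p)) linear_sum mulr_suml.
  apply: (le_trans (ler_norm_sum _ _ _)); apply: ler_sum => j _.
  rewrite linearZ normrM mulrC -deriveE; last exact/df/SU.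
  by rewrite ler_pM ?hB ?rV_coord_le.
pose g (t : R) := f (t *: (q - p) + p).
have Sg (t : R) : t \in `[0, 1]%R -> simplex (t *: (q - p) + p).
  by rewrite in_itv/= => ?; exact: simplex_segment.
have dg (t : R) : t \in `[0, 1]%R -> is_derive t 1 g ('D_(q - p) f (t *: (q - p) + p)).
  move=> /Sg/SU/df dft; rewrite deriveE//.
  have dl : is_diff t (fun s : R => s *: (q - p) + p) (fun s : R => s *: (q - p)).
    have -> : (fun s : R => s *: (q - p)) = (fun s : R => s *: (q - p)) + (fun=> 0).
      by apply/funext => s; rewrite fctE addr0.
    exact: is_diffD.
  have dfg : differentiable g t by apply: differentiable_comp => //; case: dl.
  apply: DeriveDef; first exact: diff_derivable.
  rewrite deriveE// diff_comp//=; congr ('d f _ _).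
  by rewrite (@diff_val _ _ _ _ _ _ _ dl)/= scale1r.
have cg : {within `[0, 1], continuous g}.
  by apply: derivable_within_continuous => x /dg[].
have dg' (t : R) : t \in `]0, 1[%R ->
    is_derive t 1 g ('D_(q - p) f (t *: (q - p) + p)).
  by move=> t01; apply/dg; exact: subset_itv_oo_cc.
have [t t01] := MVT_segment ler01 dg' cg.
rewrite /g scale1r scale0r add0r subrK subr0 mulr1 => ->.
exact/Dle/Sg.
Qed.

Lemma is_norm_ge0 (R : realType) (d : nat) (N : 'rV[R]_d -> R) v :
  is_norm N -> 0 <= N v.
Proof.
move=> [ND NZ _].
have N0 : N 0 = 0 by rewrite -[0](scale0r (0 : 'rV[R]_d)) NZ normr0 mul0r.
have := ND v ((-1) *: v); rewrite NZ normrN1 scaleN1r subrr N0; lra.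
Qed.

(** [C1] is the minimum of [N] on the unit sphere of the sup norm: attained by compactness, positive
    by definiteness. *)
Lemma norm_equiv (R : realType) (d : nat) (N : 'rV[R]_d -> R) :
  is_norm N -> (0 < d)%N ->
  exists C1 C2 : R, [/\ 0 < C1, 0 < C2 &
    forall v, C1 * `|v| <= N v /\ N v <= C2 * `|v|].
Proof.
move=> nN d0; have [ND NZ N0] := nN.
have Nge0 v := is_norm_ge0 v nN.
have N00 : N 0 = 0 by rewrite -[0](scale0r (0 : 'rV[R]_d)) NZ normr0 mul0r.
pose C2 := \sum_j N (delta_mx 0 j) + 1.
have C20 : 0 < C2 by rewrite ltr_wpDl// sumr_ge0.
have Nup v : N v <= C2 * `|v|.
  apply: (@le_trans _ _ (\sum_j N (v 0 j *: delta_mx 0 j))).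
    rewrite {1}(row_sum_delta v).
    elim/big_ind2 : _ => [|x a y b xa yb|//]; first by rewrite N00.
    by apply: (le_trans (ND _ _)); rewrite lerD.
  rewrite mulrDl mulr_suml; apply: ler_wpDr; first by rewrite mul1r.
  by apply: ler_sum => j _; rewrite NZ mulrC ler_wpM2l// rV_coord_le.
have NB u v : `|N u - N v| <= N (u - v).
  have h x y : N x - N y <= N (x - y).
    by have := ND (x - y) y; rewrite subrK; lra.
  rewrite ler_norml h andbT lerNl opprB (le_trans (h _ _))//.
  by rewrite -opprB -scaleN1r NZ normrN1 mul1r.
have Nc : continuous N.
  move=> v; apply: (@cvgrPdist_le _ _ _ (nbhs v) _ N (N v)).2 => e e0.
  near=> u.
  rewrite (le_trans (NB _ _))// (le_trans (Nup _))// mulrC -ler_pdivlMr//.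
  near: u; apply: (@cvgr_dist_le _ _ _ (nbhs v) _ idfun v cvg_id).
  exact: divr_gt0.
pose S := [set v : 'rV[R]_d | `|v| = 1].
have cS : compact S.
  apply: bounded_closed_compact.
    by exists 1; split=> // M M1 v /= ->; exact: ltW.
  have /continuous_closedP h := @norm_continuous R 'rV[R]_d.
  exact: (h _ (@closed_eq R 1)).
pose i : 'I_d := Ordinal d0.
have S0 : S !=set0.
  exists (delta_mx 0 i); apply/eqP; rewrite eq_le; apply/andP; split.
    apply: rV_normP => // j; rewrite mxE /=.
    by case: eqP => _; rewrite ?normr1 ?normr0.
  by have := rV_coord_le (delta_mx 0 i : 'rV[R]_d) i; rewrite mxE !eqxx normr1.
have [w /set_mem Sw wmin] := EVT_min_rV S0 cS (continuous_subspaceT Nc).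
exists (N w), C2; split=> //.
  rewrite lt_neqAle Nge0 andbT eq_sym; apply/eqP => /N0 w0.
  by move: Sw; rewrite /S/= w0 normr0 => /esym/eqP; rewrite oner_eq0.
move=> v; split=> //; have [->|v0] := eqVneq v 0; first by rewrite normr0 mulr0.
have nv : 0 < `|v| by rewrite normr_gt0.
have := wmin (`|v|^-1 *: v); rewrite NZ normfV normr_id mulrC ler_pdivlMr//; apply.
by apply/mem_set; rewrite /S/= normrZ normfV normr_id mulVf ?gt_eqF.
Unshelve. all: by end_near. Qed.

(** * Estimates for the Gibbs matrix *)

(* A seminorm vanishing exactly on the constant vectors; it is equivalent to
   the quotient norm of [R^d / R] but involves no infimum. *)
Definition oscv (R : realType) (d : nat) (i0 : 'I_d) (V : 'rV[R]_d) : R :=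
  `|V - const_mx (V 0 i0)|.

Section GibbsEstimates.
Variables (R : realType) (d : nat) (c : 'I_d -> 'I_d -> 'rV[R]_d -> R) (eps : R).
Hypothesis eps_gt0 : 0 < eps.
Implicit Types (p V : 'rV[R]_d) (i j k : 'I_d) (M L l t a b : R).

Lemma gibbs_le1 p V i j : gibbs c eps p V i j <= 1.
Proof.
rewrite -((gibbs_stochastic c eps p V).2 i) (bigD1 j)//= lerDl.
by apply: sumr_ge0 => k _; exact/ltW/gibbs_gt0.
Qed.

Lemma weight_le p V p' V' i i' t j :
  c i' j p' + V' 0 j <= c i j p + V 0 j + t ->
  weight c eps p V i j <= expR (t / eps) * weight c eps p' V' i' j.
Proof.
move=> h; rewrite /weight -expRD ler_expR -mulrDl.
by rewrite ler_pM2r ?invr_gt0//; move: h; lra.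
Qed.

Lemma sum_weight_le p V p' V' i i' t :
  (forall j, c i' j p' + V' 0 j <= c i j p + V 0 j + t) ->
  \sum_j weight c eps p V i j <=
    expR (t / eps) * \sum_j weight c eps p' V' i' j.
Proof. by move=> h; rewrite mulr_sumr ler_sum// => j _; exact: weight_le. Qed.

(** The weight contributes the factor [expR (b / eps)] and the normalizing sum [expR (a / eps)].
    Adding a constant to [V] leaves [a + b] unchanged. *)
Lemma gibbs_ratio p V p' V' i i' a b j :
  (forall j, c i j p + V 0 j - (c i' j p' + V' 0 j) <= a) ->
  (forall j, c i' j p' + V' 0 j - (c i j p + V 0 j) <= b) ->
  gibbs c eps p V i j <= expR ((a + b) / eps) * gibbs c eps p' V' i' j.
Proof.
move=> ha hb.
have {}ha k : c i k p + V 0 k <= c i' k p' + V' 0 k + a by rewrite -lerBlDl.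
have {}hb k : c i' k p' + V' 0 k <= c i k p + V 0 k + b by rewrite -lerBlDl.
rewrite !mxE ler_pdivrMr ?sum_weight_gt0//.
apply: (le_trans (weight_le (hb j))); rewrite mulrDl expRD.
have := sum_weight_le ha; have := sum_weight_gt0 c eps p' V' i'.
set S' := \sum_k _; set S := \sum_k _ => S0 hS; set w' := weight _ _ _ _ _ _.
rewrite (_ : expR (a / eps) * expR (b / eps) * (w' / S') * S =
  expR (b / eps) * w' * (expR (a / eps) * S / S')); last by ring.
by rewrite ler_peMr ?mulr_ge0 ?expR_ge0// ler_pdivlMr// mul1r.
Qed.

(** The constant [l] drops out by normalization. With [u = 2 * t / eps], an entry [x] and its
    counterpart [y] satisfy [expR (- u) * x <= y], so [x - y <= (1 - expR (- u)) * x <= u] because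
    [x <= 1]. *)
Lemma gibbs_close p V p' V' i l t j :
  (forall j, `|c i j p + V 0 j - (c i j p' + V' 0 j) - l| <= t) ->
  `|gibbs c eps p V i j - gibbs c eps p' V' i j| <= 2 * t / eps.
Proof.
suff H (q W q' W' : 'rV[R]_d) l' :
    (forall j, `|c i j q + W 0 j - (c i j q' + W' 0 j) - l'| <= t) ->
    gibbs c eps q W i j - gibbs c eps q' W' i j <= 2 * t / eps.
  move=> h; rewrite ler_norml (H _ _ _ _ _ h) andbT lerNl opprB.
  apply: (H _ _ _ _ (- l)) => k.
  by rewrite -normrN; apply: le_trans (h k); rewrite le_eqVlt; apply/orP; left;
    apply/eqP; congr `|_|; ring.
move=> h.
have h1 k : c i k q' + W' 0 k - (c i k q + W 0 k) <= t - l'.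
  by have := h k; rewrite ler_norml => /andP[]; lra.
have h2 k : c i k q + W 0 k - (c i k q' + W' 0 k) <= t + l'.
  by have := h k; rewrite ler_norml => /andP[]; lra.
have := gibbs_ratio j h2 h1.
rewrite (_ : t + l' + (t - l') = 2 * t); last by ring.
have := expR_ge1Dx (- (2 * t / eps)).
rewrite expRN.
have := expR_gt0 (2 * t / eps).
have := gibbs_le1 q W i j; have := gibbs_gt0 c eps q W i j.
have t0 : 0 <= 2 * t / eps.
  by rewrite divr_ge0 ?(ltW eps_gt0)// mulr_ge0// (le_trans _ (h j)).
move: t0; move: (gibbs _ _ _ _ _ _) => x; move: (gibbs _ _ _ _ _ _) => y.
move: (2 * t / eps) => u u0 x0 x1 E0 eE xE.
have : expR (- u) * x <= y.
  by rewrite expRN mulrC ler_pdivrMr// mulrC.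
rewrite expRN; nra.
Qed.

Lemma Gop_le p V p' V' i t :
  (forall j, c i j p + V 0 j <= c i j p' + V' 0 j + t) ->
  Gop c eps p V 0 i <= Gop c eps p' V' 0 i + t.
Proof.
move=> /sum_weight_le h; have e0 : eps != 0 by rewrite gt_eqF.
rewrite !GopE// !mulNr.
have : ln (\sum_j weight c eps p' V' i j) <=
    t / eps + ln (\sum_j weight c eps p V i j).
  rewrite -[in leRHS](@expRK R (t / eps)) -lnM ?posrE ?expR_gt0 ?sum_weight_gt0//.
  by rewrite ler_ln ?posrE ?mulr_gt0 ?expR_gt0 ?sum_weight_gt0.
rewrite -(ler_pM2l eps_gt0) mulrDr [eps * (t / eps)]mulrC divfK//; lra.
Qed.

Section Oscillation.
Variable M : R.
Variable p : 'rV[R]_d.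
Hypothesis cM : forall i k j, c i j p - c k j p <= M.

(** Both rows see the same [V], which cancels in the cost differences; hence a factor independent of
    [V]. *)
Lemma gibbs_row_ratio V i k j :
  gibbs c eps p V i j <= expR (2 * M / eps) * gibbs c eps p V k j.
Proof.
rewrite (_ : 2 * M = M + M); last by ring.
by apply: gibbs_ratio => l; [have := cM i k l|have := cM k i l]; lra.
Qed.

Lemma gibbs_row_close V i k j :
  `|gibbs c eps p V i j - gibbs c eps p V k j| <= expR (2 * M / eps) - 1.
Proof.
have r1 : 1 <= expR (2 * M / eps).
  rewrite -expR0 ler_expR divr_ge0 ?(ltW eps_gt0)// mulr_ge0//.
  by have := cM i i j; rewrite subrr.
have := gibbs_row_ratio V i k j; have := gibbs_row_ratio V k i j.
have := gibbs_le1 p V i j; have := gibbs_le1 p V k j.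
have := gibbs_gt0 c eps p V i j; have := gibbs_gt0 c eps p V k j.
rewrite ler_norml; nra.
Qed.

(* [Gop p V' 0 i - Gop p V 0 i = - eps * ln (a i)], where [a i] is the average
   of [x j = expR (- (V' 0 j - V 0 j) / eps)] against row [i] of the Gibbs
   matrix. The rows being comparable up to the factor [r = expR (2 * M / eps)],
   [a i - lo <= r * (a k - lo)] for every lower bound [lo] of [x]. *)
Lemma Gop_osc V V' l q i k : (forall j, `|V' 0 j - V 0 j - l| <= q) ->
  (Gop c eps p V' 0 k - Gop c eps p V 0 k) -
  (Gop c eps p V' 0 i - Gop c eps p V 0 i) <= (expR (2 * M / eps) - 1) * (2 * q).
Proof.
move=> h; have e0 : eps != 0 by rewrite gt_eqF.
pose x j := expR (- (V' 0 j - V 0 j) / eps).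
pose a i := \sum_j gibbs c eps p V i j * x j.
pose lo := expR (- (l + q) / eps); pose hi := expR (- (l - q) / eps).
have x_lo j : lo <= x j.
  rewrite ler_expR ler_pM2r ?invr_gt0//.
  by have := h j; rewrite ler_norml => /andP[]; lra.
have x_hi j : x j <= hi.
  rewrite ler_expR ler_pM2r ?invr_gt0//.
  by have := h j; rewrite ler_norml => /andP[]; lra.
have P1 i' := (gibbs_stochastic c eps p V).2 i'.
have P0 i' j : 0 <= gibbs c eps p V i' j by exact/ltW/gibbs_gt0.
have a_lo i' : lo <= a i'.
  by rewrite -[lo]mul1r -(P1 i') mulr_suml ler_sum// => j _; rewrite ler_wpM2l.
have a_hi i' : a i' <= hi.
  by rewrite -[hi]mul1r -(P1 i') mulr_suml ler_sum// => j _; rewrite ler_wpM2l.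
have lo0 : 0 < lo := expR_gt0 _.
have a0 i' : 0 < a i' := lt_le_trans lo0 (a_lo i').
have GE i' : Gop c eps p V' 0 i' - Gop c eps p V 0 i' = - eps * ln (a i').
  rewrite !GopE// -mulrBr -ln_div ?posrE ?sum_weight_gt0//; congr (_ * ln _).
  rewrite /a mulr_suml; apply: eq_bigr => j _.
  rewrite mxE mulrAC; congr (_ / _); rewrite -expRD; congr expR.
  by rewrite -mulrDl; congr (_ / _); ring.
rewrite !GE.
set r := expR _.
have aik : a i - lo <= r * (a k - lo).
  have E i' : a i' - lo = \sum_j gibbs c eps p V i' j * (x j - lo).
    under eq_bigr do rewrite mulrBr.
    by rewrite sumrB -mulr_suml P1 mul1r.
  rewrite !E mulr_sumr ler_sum// => j _; rewrite mulrA ler_wpM2r ?subr_ge0//.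
  exact: gibbs_row_ratio.
have r1 : 1 <= r.
  rewrite -expR0 ler_expR divr_ge0 ?(ltW eps_gt0)// mulr_ge0//.
  by have := cM i i i; rewrite subrr.
(* All averages [a i] lie in [[lo, hi]], an interval of relative width at most [2 * q / eps]. *)
have lohi : (1 - 2 * q / eps) * hi <= lo.
  rewrite (_ : lo = expR (- (2 * q / eps)) * hi).
    by rewrite ler_wpM2r ?expR_ge0// expR_ge1Dx.
  by rewrite -expRD; congr expR; field.
have q0 : 0 <= 2 * q / eps.
  by rewrite divr_ge0 ?(ltW eps_gt0)// mulr_ge0// (le_trans _ (h i)).
(* By [ln (1 + z) <= z] it suffices to bound [a i - a k], which by [aik] is at most
   [(r - 1) * (a k - lo)]. *)
have lnik : ln (a i) - ln (a k) <= (r - 1) * (2 * q / eps).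
  rewrite -ln_div ?posrE//.
  rewrite (_ : a i / a k = 1 + (a i - a k) / a k); last first.
    by field; rewrite gt_eqF.
  apply: le_trans (le_ln1Dx _) _.
    by rewrite ltr_pdivlMr//; have := a0 i; lra.
  have ak : a k - lo <= 2 * q / eps * a k.
    move: (a_hi k) (a0 k) lohi q0; move: (a k) (2 * q / eps) => y u.
    (* For [u <= 1] use [lohi] and [y <= hi]; for [u > 1] the positivity of [lo] is enough. *)
    by have [u1|u1] := leP u 1; nra.
  rewrite ler_pdivrMr// -mulrA.
  have r1' : 0 <= r - 1 by rewrite subr_ge0.
  by have := ler_wpM2l r1' ak; move: aik; lra.
have := ler_wpM2l (ltW eps_gt0) lnik.
rewrite (_ : eps * ((r - 1) * (2 * q / eps)) = (r - 1) * (2 * q)); last by field.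
lra.
Qed.

End Oscillation.

End GibbsEstimates.

(** * The oscillation seminorm *)

Section Oscv.
Variables (R : realType) (d : nat) (i0 : 'I_d).
Implicit Types V W : 'rV[R]_d.

Lemma oscv_coord V j : `|V 0 j - V 0 i0| <= oscv i0 V.
Proof. by have := rV_coord_le (V - const_mx (V 0 i0)) j; rewrite !mxE. Qed.

Lemma oscv_le V b : 0 <= b -> (forall j, `|V 0 j - V 0 i0| <= b) ->
  oscv i0 V <= b.
Proof. by move=> b0 h; apply: rV_normP => // j; rewrite !mxE. Qed.

Lemma oscv_shift V l : oscv i0 (V + const_mx l) = oscv i0 V.
Proof.
by rewrite /oscv; congr `|_|; apply/rowP => j; rewrite !mxE; ring.
Qed.

Lemma oscv_le_norm V : oscv i0 V <= 2 * `|V|.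
Proof.
apply: oscv_le => [|j]; first by rewrite mulr_ge0.
rewrite (le_trans (ler_normB _ _))//.
by have := rV_coord_le V j; have := rV_coord_le V i0; lra.
Qed.

Lemma oscv_eq0 V : oscv i0 V <= 0 -> V = const_mx (V 0 i0).
Proof. by rewrite normr_le0 subr_eq0 => /eqP. Qed.

End Oscv.

Lemma expR_sub1_le (R : realType) (x : R) : 0 <= x -> 2 * x <= 1 ->
  expR x - 1 <= 2 * x.
Proof.
move=> x0 x1; have := expR_ge1Dx (- x); rewrite expRN => h.
have E0 := expR_gt0 x.
have := ler_wpM2l (ltW E0) h; rewrite mulfV ?gt_eqF//; nra.
Qed.

(** * Lipschitz estimates for [Kop] and [Gop] *)

Section Lipschitz.
Variables (R : realType) (d : nat) (c : 'I_d -> 'I_d -> 'rV[R]_d -> R) (eps : R).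
Variables (M L : R) (i0 : 'I_d).
Hypotheses (eps_gt0 : 0 < eps) (M0 : 0 <= M) (L0 : 0 <= L).
Hypothesis cM : forall i k j p, simplex p -> c i j p - c k j p <= M.
Hypothesis cL : forall i j p q, simplex p -> simplex q ->
  `|c i j p - c i j q| <= L * `|p - q|.
Implicit Types (p V : 'rV[R]_d) (i j k : 'I_d).

(** Since [p - p'] has zero sum, row [i0] can be subtracted from every row of the matrix it
    multiplies, leaving only row differences. The rest is an average, with weights [p'], of
    differences between the two matrices. *)
Lemma Kop_dist p p' V V' rho tau : simplex p -> simplex p' ->
  (forall i j, `|gibbs c eps p V i j - gibbs c eps p V i0 j| <= rho) ->
  (forall i j, `|gibbs c eps p V i j - gibbs c eps p' V' i j| <= tau) ->
  `|Kop c eps V p - Kop c eps V' p'| <= d%:R * rho * `|p - p'| + tau.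
Proof.
move=> Sp Sp' hr ht.
have r0 : 0 <= rho by apply: le_trans (hr i0 i0).
have t0 : 0 <= tau by apply: le_trans (ht i0 i0).
apply: rV_normP => [|j]; first by rewrite addr_ge0// !mulr_ge0.
rewrite /Kop.
have -> : (p *m gibbs c eps p V - p' *m gibbs c eps p' V') 0 j =
   \sum_i (p - p') 0 i * (gibbs c eps p V i j - gibbs c eps p V i0 j) +
   \sum_i p' 0 i * (gibbs c eps p V i j - gibbs c eps p' V' i j).
  have s0 : \sum_i (p - p') 0 i = 0.
    under eq_bigr do rewrite !mxE.
    by rewrite sumrB Sp.2 Sp'.2 subrr.
  have -> : \sum_i (p - p') 0 i * (gibbs c eps p V i j - gibbs c eps p V i0 j) =
      \sum_i (p - p') 0 i * gibbs c eps p V i j.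
    under eq_bigr do rewrite mulrBr.
    by rewrite sumrB -mulr_suml s0 mul0r subr0.
  rewrite mxE [X in _ + X]mxE [X in X + _]mxE [X in - X]mxE.
  rewrite -sumrB -big_split/=; apply: eq_bigr => i _.
  by rewrite [(p - p') 0 i]mxE [(- p') 0 i]mxE; ring.
apply: (le_trans (ler_normD _ _)); apply: lerD.
  apply: (le_trans (ler_norm_sum _ _ _)).
  apply: (@le_trans _ _ (\sum_(i < d) `|p - p'| * rho)).
    by apply: ler_sum => i _; rewrite normrM ler_pM// rV_coord_le.
  by rewrite sumr_const card_ord -(mulr_natl (_ * rho)) mulrA mulrAC lexx.
apply: (le_trans (ler_norm_sum _ _ _)).
rewrite -[leRHS]mul1r -Sp'.2 mulr_suml; apply: ler_sum => i _.
by rewrite normrM ger0_norm ?Sp'.1// ler_wpM2l ?Sp'.1.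
Qed.

Hypothesis epsM : 4 * M <= eps.

(** One rate for three dependences: [4 * M * d + 2 * L] serves [Kop] in [p], [2] serves [Kop] in
    [V], and [8 * M] serves [Gop] in [V]. *)
Definition contraction_rate : R := (4 * M * (d%:R + 2) + 2 * L + 2) / eps.

Lemma row_rate_le : expR (2 * M / eps) - 1 <= 4 * M / eps.
Proof.
rewrite (_ : 4 * M / eps = 2 * (2 * M / eps)); last by ring.
apply: expR_sub1_le; first by rewrite divr_ge0 ?mulr_ge0// ltW.
by rewrite mulrA ler_pdivrMr//; move: epsM; lra.
Qed.

Lemma Kop_lipschitz p p' V V' : simplex p -> simplex p' ->
  `|Kop c eps V p - Kop c eps V' p'| <=
    contraction_rate * (`|p - p'| + oscv i0 (V - V')).
Proof.
move=> Sp Sp'; set a := `|p - p'|; set b := oscv i0 (V - V').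
have hr i j : `|gibbs c eps p V i j - gibbs c eps p V i0 j| <= 4 * M / eps.
  by rewrite (le_trans _ row_rate_le)// gibbs_row_close// => i' k' j'; exact: cM.
have ht i j : `|gibbs c eps p V i j - gibbs c eps p' V' i j| <=
    2 * (L * a + b) / eps.
  apply: (gibbs_close eps_gt0 (l := (V - V') 0 i0)) => k.
  rewrite (_ : _ - _ = (c i k p - c i k p') + ((V - V') 0 k - (V - V') 0 i0)).
    by rewrite (le_trans (ler_normD _ _))// lerD ?cL// oscv_coord.
  by rewrite !mxE; ring.
apply: (le_trans (Kop_dist Sp Sp' hr ht)).
have a0 : 0 <= a by exact: normr_ge0.
have b0 : 0 <= b by exact: normr_ge0.
rewrite -/a [leLHS](_ : _ = ((4 * M * d%:R + 2 * L) * a + 2 * b) / eps); last by ring.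
rewrite /contraction_rate [leRHS]mulrAC ler_pM2r ?invr_gt0//.
have d0 : 0 <= M * d%:R by rewrite mulr_ge0.
have := mulr_ge0 d0 b0; have := mulr_ge0 M0 a0; have := mulr_ge0 M0 b0.
have := mulr_ge0 L0 b0; move: a0; lra.
Qed.

(** Compare through [Gop c eps p V']: changing [V] is governed by [Gop_osc], and changing [p] moves
    each coordinate by at most [L * a]. The oscillation involves two coordinates, hence [2 * L]. *)
Lemma Gop_lipschitz p p' V V' : simplex p -> simplex p' ->
  oscv i0 (Gop c eps p V - Gop c eps p' V') <=
    2 * L * `|p - p'| + contraction_rate * oscv i0 (V - V').
Proof.
move=> Sp Sp'; set a := `|p - p'|; set b := oscv i0 (V - V').
have a0 : 0 <= a by exact: normr_ge0.
have b0 : 0 <= b by exact: normr_ge0.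
have rateE : 2 * (4 * M / eps) <= contraction_rate.
  rewrite /contraction_rate mulrA ler_pM2r ?invr_gt0//.
  have : 0 <= M * d%:R by rewrite mulr_ge0.
  by move: L0; lra.
have k0 : 0 <= contraction_rate.
  by apply: le_trans rateE; rewrite mulr_ge0// divr_ge0 ?mulr_ge0// ltW.
have hV i k : (Gop c eps p V 0 k - Gop c eps p V' 0 k) -
    (Gop c eps p V 0 i - Gop c eps p V' 0 i) <= contraction_rate * b.
  have cMp i' k' j' : c i' j' p - c k' j' p <= M by exact: cM.
  apply: (le_trans (Gop_osc eps_gt0 cMp (l := (V - V') 0 i0) (q := b) _ _ _)).
    by move=> j; have := oscv_coord i0 (V - V') j; rewrite !mxE.
  rewrite mulrA ler_wpM2r//; apply: le_trans rateE.
  by have := row_rate_le; lra.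
have hp i : `|Gop c eps p V' 0 i - Gop c eps p' V' 0 i| <= L * a.
  rewrite ler_norml; apply/andP; split.
    rewrite lerNl opprB lerBlDl; apply: Gop_le => // j.
    by have := cL i j Sp Sp'; rewrite -/a ler_norml => /andP[]; lra.
  rewrite lerBlDl; apply: Gop_le => // j.
  by have := cL i j Sp Sp'; rewrite -/a ler_norml => /andP[]; lra.
apply: oscv_le => [|j]; first by rewrite addr_ge0 ?(mulr_ge0 k0)// !mulr_ge0.
have E k : (Gop c eps p V - Gop c eps p' V') 0 k =
    Gop c eps p V 0 k - Gop c eps p' V' 0 k by rewrite !mxE.
rewrite !E.
have := hV i0 j; have := hV j i0; have := hp i0; have := hp j.
rewrite !ler_norml => /andP[] + + /andP[]; lra.
Qed.

End Lipschitz.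

(** * Contraction and fixed points of the squared map *)

(* The library has both structures on matrices; repeating the completeness
   instance over a [realType] is what makes them join into
   [completeNormedModType]. *)
HB.instance Definition _ (R : realType) m n :=
  Uniform_isComplete.Build 'M[R]_(m, n) (@mx_complete R m n).

Lemma lipschitz_continuous (R : realType) (V W : normedModType R) (f : V -> W)
    (k : R) :
  (forall x y, `|f x - f y| <= k * `|x - y|) -> continuous f.
Proof.
move=> fk x; apply/cvgrPdist_le => e e0; near=> y.
have k0 : 0 < `|k| + 1 by rewrite ltr_wpDl.
have ? : `|x - y| <= e / (`|k| + 1).
  near: y; apply: cvgr_dist_le; first exact: cvg_id.
  exact: divr_gt0.
rewrite (le_trans (fk x y))// (@le_trans _ _ ((`|k| + 1) * `|x - y|))//.
  by rewrite ler_wpM2r// (le_trans (ler_norm _))// lerDl.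
by rewrite mulrC -ler_pdivlMr.
Unshelve. all: by end_near. Qed.

Lemma lsubmx_norm_le (R : realType) (m n : nat) (x : 'rV[R]_(m + n)) :
  `|lsubmx x| <= `|x|.
Proof. by apply: rV_normP => // j; rewrite mxE rV_coord_le. Qed.

Lemma rsubmx_norm_le (R : realType) (m n : nat) (x : 'rV[R]_(m + n)) :
  `|rsubmx x| <= `|x|.
Proof. by apply: rV_normP => // j; rewrite mxE rV_coord_le. Qed.

Lemma row_mx_norm_le (R : realType) (m n : nat) (u : 'rV[R]_m) (v : 'rV[R]_n) b :
  `|u| <= b -> `|v| <= b -> `|row_mx u v| <= b.
Proof.
move=> ub vb; apply: rV_normP => [|j]; first exact: le_trans ub.
by rewrite mxE; case: splitP => k _; [apply: le_trans ub|apply: le_trans vb];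
  exact: rV_coord_le.
Qed.

Section FixedPoint.
Local Open Scope quotient_scope.
Variables (R : realType) (d : nat) (c : 'I_d -> 'I_d -> 'rV[R]_d -> R) (eps : R).
Variables (i0 : 'I_d) (A kap : R).
Hypotheses (A0 : 0 <= A) (kap0 : 0 <= kap) (kap1 : kap <= 1).
Hypothesis K_lip : forall (p q V W : 'rV[R]_d), simplex p -> simplex q ->
  `|Kop c eps V p - Kop c eps W q| <= kap * (`|p - q| + oscv i0 (V - W)).
Hypothesis G_lip : forall (p q V W : 'rV[R]_d), simplex p -> simplex q ->
  oscv i0 (Gop c eps p V - Gop c eps q W) <=
    A * `|p - q| + kap * oscv i0 (V - W).
Implicit Types (p q V W : 'rV[R]_d).

Definition K2 p V := Kop c eps (Gop c eps p V) (Kop c eps V p).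
Definition G2 p V := Gop c eps (Kop c eps V p) (Gop c eps p V).

(* The coefficient [A] is not small, but every path of two steps picks up at
   least one factor [kap]. *)
Lemma two_step p q V W : simplex p -> simplex q ->
  let s := kap * (2 + 2 * A) * (`|p - q| + oscv i0 (V - W)) in
  `|K2 p V - K2 q W| <= s /\ oscv i0 (G2 p V - G2 q W) <= s.
Proof.
move=> Sp Sq /=.
have S1 : simplex (Kop c eps V p) by exact: Kop_simplex.
have S2 : simplex (Kop c eps W q) by exact: Kop_simplex.
have hK := K_lip V W Sp Sq; have hG := G_lip V W Sp Sq.
have hK2 := K_lip (Gop c eps p V) (Gop c eps q W) S1 S2.
have hG2 := G_lip (Gop c eps p V) (Gop c eps q W) S1 S2.
rewrite -/(K2 p V) -/(K2 q W) in hK2; rewrite -/(G2 p V) -/(G2 q W) in hG2.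
have a0 : 0 <= `|p - q| by exact: normr_ge0.
have b0 : 0 <= oscv i0 (V - W) by exact: normr_ge0.
move: a0 b0 hK hG hK2 hG2.
move: `|p - q| (oscv i0 (V - W)) => a b.
move: `|Kop c eps V p - _| (oscv i0 (Gop c eps p V - _)) => a1 b1.
move: `|K2 p V - _| (oscv i0 (G2 p V - _)) => a2 b2.
move=> a0 b0 ha1 hb1 ha2 hb2.
have ka : kap * a <= a by rewrite ler_piMl.
have kb : kap * b <= b by rewrite ler_piMl.
have Aa : 0 <= A * a by rewrite mulr_ge0.
have Ab : 0 <= A * b by rewrite mulr_ge0.
split.
  apply: (le_trans ha2); rewrite -mulrA ler_wpM2l//; lra.
have := ler_wpM2l A0 ha1.
have hb1' : b1 <= (A + 1) * (a + b) by lra.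
have := ler_wpM2l kap0 hb1'.
have := mulr_ge0 kap0 a0; have := mulr_ge0 kap0 b0.
lra.
Qed.

(** A metric free of infima in which the contraction is proved; it does not depend on the
    representatives because [oscv] ignores constants. *)
Definition sdist (x y : state R d) : R :=
  `|val x.1 - val y.1| + oscv i0 (repr x.2 - repr y.2).

Lemma oscv_repr_pi V W :
  oscv i0 (repr (\pi_(potential R d) V) - repr (\pi_(potential R d) W)) =
  oscv i0 (V - W).
Proof.
have [l ->] := repr_pi V; have [m ->] := repr_pi W.
rewrite -(oscv_shift i0 (V - W) (l - m)); congr oscv.
by apply/rowP => j; rewrite !mxE; ring.
Qed.

Lemma sdist_eq0 x y : sdist x y <= 0 -> x = y.
Proof.
case: x y => [p psi] [q phi]; rewrite /sdist/= => h.
have a0 : 0 <= `|val p - val q| by exact: normr_ge0.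
have b0 : 0 <= oscv i0 (repr psi - repr phi) by exact: normr_ge0.
congr pair.
  by apply/val_inj/eqP; rewrite -subr_eq0 -normr_le0; lra.
have /oscv_eq0 E : oscv i0 (repr psi - repr phi) <= 0 by lra.
rewrite -[LHS]reprK -[RHS]reprK; apply/potential_eqP.
by exists ((repr psi - repr phi) 0 i0); rewrite -E addrC subrK.
Qed.

Let T2 := Tmap c eps \o Tmap c eps.

Lemma val_T2 x : val (T2 x).1 = K2 (val x.1) (repr x.2).
Proof. exact: val_Kq. Qed.

Lemma T2_pi x : (T2 x).2 = \pi_(potential R d) (G2 (val x.1) (repr x.2)).
Proof. exact: Gq_pi. Qed.

Lemma simplex_val (p : set_type (@simplex R d)) : simplex (val p).
Proof. exact: set_mem (valP p). Qed.

(** Each of the two components is bounded by [two_step], which doubles its constant. *)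
Lemma sdist_T2 x y : sdist (T2 x) (T2 y) <= kap * (4 + 4 * A) * sdist x y.
Proof.
rewrite /sdist !val_T2 !T2_pi oscv_repr_pi.
have [] := two_step (repr x.2) (repr y.2) (simplex_val x.1) (simplex_val y.1).
lra.
Qed.

Lemma T2_fixed_unique x y : kap * (4 + 4 * A) < 1 ->
  T2 x = x -> T2 y = y -> x = y.
Proof.
move=> k1 xx yy; have := sdist_T2 x y; rewrite xx yy => h.
apply: sdist_eq0; rewrite leNgt; apply/negP => h0.
by move: h; rewrite leNgt gtr_pMl// k1.
Qed.

(* Products are not known to be complete in the library, so that the pair
   [(p, V)] is encoded as [row_mx p V], with [V] normalized by [V 0 i0 = 0]
   in the image of [F]. *)
Let U : set 'rV[R]_(d + d) := [set x | simplex (lsubmx x)].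
Let F (x : 'rV[R]_(d + d)) : 'rV[R]_(d + d) :=
  row_mx (K2 (lsubmx x) (rsubmx x))
    (G2 (lsubmx x) (rsubmx x) - const_mx (G2 (lsubmx x) (rsubmx x) 0 i0)).

(** The constant of [two_step] is tripled, since [oscv] may be twice the sup norm of its half and
    the other half adds one more. *)
Lemma F_lip x y : U x -> U y ->
  `|F x - F y| <= kap * (6 + 6 * A) * `|x - y|.
Proof.
move=> Ux Uy.
have [h1 h2] := two_step (rsubmx x) (rsubmx y) Ux Uy.
rewrite /F opp_row_mx add_row_mx.
set s := _ * _ in h1 h2; have hs : s <= kap * (6 + 6 * A) * `|x - y|.
  have l1 : `|lsubmx x - lsubmx y| <= `|x - y|.
    by rewrite -raddfB lsubmx_norm_le.
  have l2 : oscv i0 (rsubmx x - rsubmx y) <= 2 * `|x - y|.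
    apply: (le_trans (oscv_le_norm _ _)); rewrite ler_wpM2l//.
    by rewrite -raddfB rsubmx_norm_le.
  have l3 : `|lsubmx x - lsubmx y| + oscv i0 (rsubmx x - rsubmx y) <=
    3 * `|x - y| by lra.
  have k2 : 0 <= kap * (2 + 2 * A).
    by rewrite mulr_ge0// addr_ge0// mulr_ge0.
  by have := ler_wpM2l k2 l3; rewrite -/s; lra.
apply: row_mx_norm_le; first exact: le_trans h1 hs.
apply: le_trans hs; apply: le_trans h2.
(* The normalization makes the norm of the second half equal to the oscillation of the [G2]
   difference. *)
rewrite /oscv le_eqVlt; apply/orP; left; apply/eqP; congr `|_|.
by apply/rowP => j; rewrite !mxE; ring.
Qed.

Lemma U_closed : closed U.
Proof.
have lc : continuous (@lsubmx R 1 d d).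
  apply: (@lipschitz_continuous _ _ _ _ 1) => x y.
  by rewrite mul1r -raddfB lsubmx_norm_le.
by move/continuous_closedP : lc => h; exact: (h _ (@simplex_closed R d)).
Qed.

Lemma F_fun : {homo F : x / U x}.
Proof. by move=> x Ux; rewrite /U/= row_mxKl; do 2 apply: Kop_simplex. Qed.

Lemma T2_fixed_exists : kap * (6 + 6 * A) < 1 -> exists x, T2 x = x.
Proof.
move=> k1.
have k0 : 0 <= kap * (6 + 6 * A) by rewrite mulr_ge0// addr_ge0// mulr_ge0.
have ctr : is_contraction (mkfun_fun F_fun).
  exists (NngNum k0); split=> //= -[x y] [/= Ux Uy]; exact: F_lip.
have U0 : U !=set0.
  exists (row_mx (delta_mx 0 i0) 0); rewrite /U/= row_mxKl.
  exact: simplex_delta.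
have [x Ux xF] := banach_fixed_point ctr U_closed U0.
have Sx : simplex (lsubmx x) := Ux.
have xl : K2 (lsubmx x) (rsubmx x) = lsubmx x by rewrite [in RHS]xF /= row_mxKl.
have xr : G2 (lsubmx x) (rsubmx x) =
    rsubmx x + const_mx (G2 (lsubmx x) (rsubmx x) 0 i0).
  by rewrite [in X in _ = X + _]xF /= row_mxKr subrK.
(* A fixed point of [F] satisfies the [G2] equation only up to a constant, which vanishes in the
   quotient. *)
pose s : state R d :=
  (SigSub (mem_set Sx), \pi_(potential R d) (rsubmx x)).
have [l sl] := repr_pi (rsubmx x).
exists s; rewrite [LHS]surjective_pairing; congr pair.
  apply: val_inj; rewrite val_T2 -[RHS]xl.
  by rewrite /K2 /= sl Gop_shift !Kop_shift.
rewrite T2_pi; apply/potential_eqP.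
exists (G2 (lsubmx x) (rsubmx x) 0 i0 + l).
rewrite /G2 /= sl Kop_shift !Gop_shift -/(G2 _ _) [in LHS]xr.
by apply/rowP => j; rewrite !mxE; ring.
Qed.

End FixedPoint.

(** * Comparison of [sdist] with the metric induced by [N] *)

Section Distance.
Variables (R : realType) (d : nat) (i0 : 'I_d) (N : 'rV[R]_d -> R) (C1 C2 : R).
Hypotheses (C1_gt0 : 0 < C1) (C2_gt0 : 0 < C2).
Hypothesis NC : forall v, C1 * `|v| <= N v /\ N v <= C2 * `|v|.
Local Open Scope quotient_scope.

(** Every representative has sup norm at least half the oscillation, and the one vanishing at [i0]
    has sup norm equal to it. *)
Lemma qnorm_equiv (v : 'rV[R]_d) (q := qnorm N (\pi_(potential R d) v)) :
  C1 * oscv i0 v <= 2 * q /\ q <= C2 * oscv i0 v.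
Proof.
rewrite /q qnorm_pi; set S := [set _ | _ in _].
have Slb : lbound S (C1 * oscv i0 v / 2).
  move=> _ [l _ <-]; apply: (le_trans _ (NC _).1).
  rewrite -mulrA ler_wpM2l ?(ltW C1_gt0)// ler_pdivrMr//.
  by rewrite -(oscv_shift i0 v l) mulrC oscv_le_norm.
have Sv : S (N (v + const_mx (- v 0 i0))) by exists (- v 0 i0).
split.
  suff : C1 * oscv i0 v / 2 <= inf S by lra.
  by apply: lb_le_inf => //; exists (N (v + const_mx (- v 0 i0))).
apply: (@le_trans _ _ (N (v + const_mx (- v 0 i0)))).
  by apply: ge_inf => //; exists (C1 * oscv i0 v / 2).
apply: (le_trans (NC _).2); rewrite ler_wpM2l ?(ltW C2_gt0)//.
by rewrite le_eqVlt; apply/orP; left; apply/eqP; congr `|_|;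
   apply/rowP => j; rewrite !mxE.
Qed.

Lemma dist_equiv (x y : state R d) :
  C1 * sdist i0 x y <= 2 * dist N x y /\ dist N x y <= C2 * sdist i0 x y.
Proof.
have E : x.2 - y.2 = \pi_(potential R d) (repr x.2 - repr y.2).
  by rewrite -[in LHS](reprK x.2) -[in LHS](reprK y.2) -raddfB.
rewrite /dist /sdist E.
have [h1 h2] := qnorm_equiv (repr x.2 - repr y.2).
have [h3 h4] := NC (val x.1 - val y.1).
split; rewrite mulrDr; last exact: lerD.
rewrite [leRHS]mulrDr lerD// (le_trans h3)// ler_peMl ?ler1n//.
by rewrite (le_trans _ h3)// mulr_ge0// ltW.
Qed.

End Distance.

(** * Uniform bounds on the costs and choice of the threshold *)

Lemma C1_family_bounds (R : realType) (d : nat)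
    (c : 'I_d -> 'I_d -> 'rV[R]_d -> R) (U : set 'rV[R]_d) :
  @simplex R d `<=` U -> (forall i j, C1_on U (c i j)) ->
  exists M L : R, [/\ 0 <= M, 0 <= L,
    forall i k j p, simplex p -> c i j p - c k j p <= M &
    forall i j p q, simplex p -> simplex q ->
      `|c i j p - c i j q| <= L * `|p - q|].
Proof.
move=> SU cC1.
have sum_ub (f : 'I_d -> 'I_d -> R) i j : (forall i j, 0 <= f i j) ->
    f i j <= \sum_i \sum_j f i j.
  move=> f0; rewrite (bigD1 i)//= (bigD1 j)//= -addrA lerDl.
  by rewrite addr_ge0 ?sumr_ge0// => k _; rewrite sumr_ge0.
have [l l0 hl] : exists2 l : 'I_d -> 'I_d -> R, (forall i j, 0 <= l i j) &
    forall i j p q, simplex p -> simplex q ->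
      `|c i j p - c i j q| <= l i j * `|p - q|.
  by exists (fun i j => s2val (cid2 (C1_lipschitz SU (cC1 i j)))) => i j;
    case: cid2.
pose L := \sum_i \sum_j l i j.
have L0 : 0 <= L by apply: sumr_ge0 => i _; exact: sumr_ge0.
have cL i j p q : simplex p -> simplex q ->
    `|c i j p - c i j q| <= L * `|p - q|.
  move=> Sp Sq; rewrite (le_trans (hl i j p q Sp Sq))// ler_wpM2r//.
  exact: sum_ub.
(* The bound [M] comes from the values at a base point [p0] and the Lipschitz constant, the simplex
   having sup-norm diameter at most 1. Without a base point it holds vacuously. *)
have [[p0 Sp0]|noS] := pselect (exists p : 'rV[R]_d, simplex p); last first.
  exists 0, L; split=> // i k j p Sp; by case: noS; exists p.
pose B := \sum_i \sum_j `|c i j p0|.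
have B0 : 0 <= B by apply: sumr_ge0 => i _; exact: sumr_ge0.
exists (2 * (B + L)), L; split=> // [|i k j p Sp].
  by rewrite mulr_ge0// addr_ge0.
have cB i' : `|c i' j p| <= B + L.
  rewrite -[c i' j p](subrK (c i' j p0)) addrC (le_trans (ler_normD _ _))//.
  rewrite lerD//; first exact: (sum_ub (fun i j => `|c i j p0|)).
  rewrite (le_trans (cL _ _ _ _ Sp Sp0))// ler_piMr//.
  exact: simplex_norm_le1.
have := cB i; have := cB k; rewrite !ler_norml => /andP[+ _] /andP[_]; lra.
Qed.

Theorem proposition10 (R : realType) (d : nat) (hd : (1 < d)%N)
    (c : 'I_d -> 'I_d -> 'rV[R]_d -> R)
    (U : set 'rV[R]_d) (openU : open U) (subU : @simplex R d `<=` U)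
    (c_C1 : forall i j, C1_on U (c i j))
    (N : 'rV[R]_d -> R) (normN : is_norm N) :
  exists2 eps0 : R, 0 < eps0 & forall eps : R, eps0 < eps ->
    (exists! x : state R d, stationary c eps x) /\
    (exists2 k : R, 0 <= k < 1 & forall x y : state R d,
       dist N ((Tmap c eps \o Tmap c eps) x) ((Tmap c eps \o Tmap c eps) y)
         <= k * dist N x y).
Proof.
have d0 : (0 < d)%N by exact: ltnW.
pose i0 : 'I_d := Ordinal d0.
have [M [L [M0 L0 cM cL]]] := C1_family_bounds subU c_C1.
have [C1 [C2 [C10 C20 NC]]] := norm_equiv normN d0.
pose A := 2 * L; pose E := 4 * M * (d%:R + 2) + 2 * L + 2.
have A0 : 0 <= A by rewrite mulr_ge0.
have E0 : 0 < E by rewrite ltr_wpDl// addr_ge0// !mulr_ge0// addr_ge0.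
(* The loss in passing from [sdist] to [dist N] and back. *)
pose C := 2 * C2 / C1.
have C0 : 0 < C by rewrite divr_gt0// mulr_gt0.
have A6 : 0 < 6 + 6 * A by lra.
have A4 : 0 < 4 + 4 * A by lra.
have e6 : 0 < E * (6 + 6 * A) by rewrite mulr_gt0.
have e4 : 0 < E * (4 + 4 * A) * C := mulr_gt0 (mulr_gt0 E0 A4) C0.
(* The summands ensure, in order, [epsM], the Banach condition [kap6] for [F], and the contraction
   [kapC] in [dist N]; here [kap] is [E / eps]. *)
exists (4 * M + E * (6 + 6 * A) + E * (4 + 4 * A) * C).
  by rewrite -addrA ltr_wpDl ?mulr_ge0// addr_gt0.
move=> eps epsgt.
have M4 : 0 <= 4 * M by rewrite mulr_ge0.
have eps_gt0 : 0 < eps by lra.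
have epsM : 4 * M <= eps by lra.
pose kap := contraction_rate d eps M L.
have kap0 : 0 < kap by rewrite /kap /contraction_rate divr_gt0.
have kap6 : kap * (6 + 6 * A) < 1.
  by rewrite /kap /contraction_rate mulrAC ltr_pdivrMr// mul1r -/E; lra.
have kapC : kap * (4 + 4 * A) * C < 1.
  by rewrite /kap /contraction_rate -mulrA mulrAC ltr_pdivrMr// mul1r mulrA -/E; lra.
have kA : 0 <= kap * A by rewrite mulr_ge0// ltW.
have kap1 : kap <= 1 by lra.
have kap4 : kap * (4 + 4 * A) < 1 by lra.
have K_lip := @Kop_lipschitz R d c eps M L i0 eps_gt0 M0 L0 cM cL epsM.
have G_lip := @Gop_lipschitz R d c eps M L i0 eps_gt0 M0 L0 cM cL epsM.
have T2_lip := sdist_T2 A0 (ltW kap0) kap1 K_lip G_lip.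
have T2_uniq := T2_fixed_unique A0 (ltW kap0) kap1 K_lip G_lip kap4.
split.
  have [x xx] := T2_fixed_exists A0 (ltW kap0) kap1 K_lip G_lip kap6.
  (* [Tmap c eps x] is again fixed by the squared map, so uniqueness identifies it with [x]. *)
  have Tx : Tmap c eps x = x.
    by apply: T2_uniq => //; rewrite -[in RHS]xx.
  exists x; split; first exact/stationaryP.
  by move=> y /stationaryP Ty; apply: T2_uniq => //; rewrite /= !Ty.
exists (kap * (4 + 4 * A) * C).
  by rewrite kapC andbT; exact: ltW (mulr_gt0 (mulr_gt0 kap0 A4) C0).
move=> x y; have [h1 _] := dist_equiv i0 C10 C20 NC x y.
have [_ h2] := dist_equiv i0 C10 C20 NC ((Tmap c eps \o Tmap c eps) x)
  ((Tmap c eps \o Tmap c eps) y).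
apply: (le_trans h2).
apply: (@le_trans _ _ (C2 * (kap * (4 + 4 * A) * sdist i0 x y))).
  by rewrite ler_wpM2l ?T2_lip// ltW.
have -> : kap * (4 + 4 * A) * C * dist N x y =
    C2 * (kap * (4 + 4 * A) * (2 * dist N x y / C1)) by rewrite /C; ring.
rewrite ler_wpM2l ?(ltW C20)// ler_wpM2l ?(ltW (mulr_gt0 kap0 A4))//.
by rewrite ler_pdivlMr// mulrC.
Qed.
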